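(* Let $\Delta\ge 3$ and $r\ge 2$ be integers and let $p=R_r(K_\Delta)$. Then there is a constant $c=c(\Delta,r)>0$ such that $f_r(G_n;p)\le cn$ for every $n$ and every graph $G_n$ of order $n$ with maximum degree $\Delta(G_n)\le\Delta$.
   Context: Graphs are finite and simple. An $r$-edge coloring of a graph is a coloring of its edges by $r$ colors. For graphs $F$ and $G$, $F\to(G)_r$ means that any $r$-edge coloring of $F$ contains a monochromatic copy of $G$ (as a not necessarily induced subgraph). $R_r(G)$ is the smallest $N$ such that $K_N\to(G)_r$; $K_\Delta$ is the complete graph on $\Delta$ vertices. $\omega(F)$ is the clique number of $F$. $f_r(G;p)$ is the smallest $N$ such that there exists a graph $F$ of order $N$ with $\omega(F)=p$ satisfying $F\to(G)_r$ (and $f_r(G;p)=\infty$ if there is no such $F$). *)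

(* Defs.v *)
From mathcomp Require Import all_boot all_order all_algebra.
From mathcomp Require Import boolp reals constructive_ereal.

Set Implicit Arguments.
Unset Strict Implicit.
Unset Printing Implicit Defensive.

Record sgraph := SGraph {
  vertex :> finType;
  adj : rel vertex;
  adj_sym : symmetric adj;
  adj_irr : irreflexive adj }.

Definition complete_rel n : rel 'I_n := fun x y => x != y.

Lemma complete_sym n : symmetric (@complete_rel n).
Proof. by move=> x y; rewrite /complete_rel eq_sym. Qed.

Lemma complete_irr n : irreflexive (@complete_rel n).
Proof. by move=> x; rewrite /complete_rel eqxx. Qed.

Definition complete n : sgraph := SGraph (@complete_sym n) (@complete_irr n).

Definition graph_order (G : sgraph) : nat := #|G|.

Definition max_degree (G : sgraph) : nat :=
  \max_(x : G) #|[set y | adj x y]|.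

Definition clique (G : sgraph) (A : {set G}) : bool :=
  [forall x in A, forall y in A, (x != y) ==> adj x y].

Definition clique_number (G : sgraph) : nat :=
  \max_(A : {set G} | clique A) #|A|.

(* An edge xy is the pair [set x; y]; a coloring is a total function on vertex
   sets, but only its values on edges of F are ever used. *)
Definition mono_copy (r : nat) (F G : sgraph) (col : {set F} -> 'I_r) : Prop :=
  exists (k : 'I_r) (f : G -> F), injective f /\
    forall x y : G, adj x y -> adj (f x) (f y) /\ col [set f x; f y] = k.

Definition arrows (r : nat) (F G : sgraph) : Prop :=
  forall col : {set F} -> 'I_r, mono_copy G col.

(* The least natural number satisfying P; None stands for infinity and is the
   value when there is no such number. *)
Definition smallest (P : nat -> Prop) : option nat :=
  match pselect (exists N, `[< P N >]) with
  | left exP => Some (ex_minn exP)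
  | right _ => None
  end.

Definition ereal_of_onat (R : realType) (o : option nat) : \bar R :=
  if o is Some N then (N%:R%:E)%E else +oo%E.

Definition ramsey (r : nat) (G : sgraph) : option nat :=
  smallest (fun N => arrows r (complete N) G).

Definition folkman (r : nat) (G : sgraph) (p : nat) : option nat :=
  smallest (fun N => exists F : sgraph,
    [/\ graph_order F = N, clique_number F = p & arrows r F G]).

(* Main.v *)
(* Put k = Delta + 1 <= p.  The partite construction of Nesetril and Rodl gives a
   graph H without a clique of size k + 1 such that every r-coloring of its edges has
   a monochromatic K_k.  Replacing each vertex of H by O(n) independent vertices
   creates no larger clique.  Given an r-coloring of this blow-up, one shrinks the
   blown-up vertices by constant factors until, for each edge of H, some color is
   lower dense between the two corresponding sets: for every large subset Y of one
   side, almost all vertices of the other side have at least |Y|/(2r) neighbors in Y.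
   No regularity lemma is needed: if the color in question fails on (X, Y), passing
   to X and the complement of Y increases its relative minimum degree.  The resulting
   coloring of H has a monochromatic K_k, and every graph of maximum degree Delta
   embeds greedily, one class of a proper k-coloring after the other, into the
   corresponding lower dense system.  A disjoint K_p makes the clique number p. *)
Require Import Defs.
From mathcomp Require Import all_boot all_order all_algebra.
From mathcomp Require Import boolp reals constructive_ereal.
From mathcomp Require Import zify.

Set Implicit Arguments.
Unset Strict Implicit.
Unset Printing Implicit Defensive.

(** * The Hales-Jewett theorem *)

Section HalesJewett.
Variable A : finType.

Definition fill (l : seq (option A)) (a : A) : seq A := map (odflt a) l.

Lemma fill_cat l1 l2 a : fill (l1 ++ l2) a = fill l1 a ++ fill l2 a.
Proof. exact: map_cat. Qed.

Lemma fill_Some s a : fill (map Some s) a = s.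
Proof. by rewrite /fill -map_comp map_id_in. Qed.

(* A line is a word with wildcards [None], of which there is at least one. *)
Definition is_line n (l : seq (option A)) := (size l == n) && (None \in l).

Definition HJ_property (s : seq A) := forall C : finType, exists n,
  forall chi : seq A -> C, exists l, is_line n l /\
    {in s &, forall a b, chi (fill l a) = chi (fill l b)}.

(* Lines that are monochromatic on [s], of pairwise distinct colors, and that all
   pass through the same word [f] at the letter [a] outside [s].  There are at
   most as many such lines as colors, which stops the induction in [focusing]. *)
Definition focused (C : eqType) (chi : seq A -> C) n (s : seq A) (a : A)
    (f : seq A) (L : seq (seq (option A) * C)) :=
  uniq (unzip2 L) /\ forall l c, (l, c) \in L ->
    [/\ is_line n l, fill l a = f & {in s, forall b, chi (fill l b) = c}].

(** Induction on [t]. The property of [s] is applied with functions as colors: a suffix is colored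
    by the colors it yields after all prefixes of length [n]. Along the suffix line obtained, the
    letters of [s] are interchangeable. The color at the focus [f] either repeats that of a line of
    [L], which becomes monochromatic on [a :: s], or gives a new focused line. *)
Lemma focusing (s : seq A) (a b : A) (C : finType) t :
  b \in s -> HJ_property s -> exists n, forall chi : seq A -> C,
    (exists l, is_line n l /\
       {in a :: s &, forall a b, chi (fill l a) = chi (fill l b)}) \/
    exists f L, [/\ size f = n, size L = t & focused chi n s a f L].
Proof.
move=> bs HJs; elim: t => [|t [n IHn]].
  by exists 0 => chi; right; exists [::], [::].
have [n' Hn'] := HJs {ffun n.-tuple A -> C}; exists (n + n') => chi.
have [w [/andP[/eqP sw Nw] monow]] :=
  Hn' (fun v => [ffun x : n.-tuple A => chi (x ++ v)]).
have {}monow x c : size x = n -> c \in s ->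
    chi (x ++ fill w c) = chi (x ++ fill w b).
  move=> /eqP sx cs; have /ffunP/(_ (Tuple sx)) := monow c b cs bs.
  by rewrite !ffunE.
have extend l : is_line n l ->
    {in a :: s &, forall c d,
       chi (fill l c ++ fill w b) = chi (fill l d ++ fill w b)} ->
    exists l, is_line (n + n') l /\
       {in a :: s &, forall a b, chi (fill l a) = chi (fill l b)}.
  move=> /andP[/eqP sl Nl] mono; exists (l ++ map Some (fill w b)); split.
    by rewrite /is_line size_cat !size_map sl sw eqxx mem_cat Nl.
  by move=> c d cs ds; rewrite !fill_cat !fill_Some; apply: mono.
have [[l [linel monol]]|[f [L [sf sL [uL focL]]]]] :=
  IHn (fun x => chi (x ++ fill w b)); first by left; apply: extend monol.
pose c0 := chi (f ++ fill w b).
have [/mapP[[l c] lL /= cE]|c0L] := boolP (c0 \in unzip2 L).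
  left; have [linel la lc] := focL l c lL; apply: (extend l linel).
  have E d : d \in a :: s -> chi (fill l d ++ fill w b) = c.
    by rewrite inE => /predU1P[->|/lc//]; rewrite la -cE.
  by move=> d e ds es; rewrite !E.
right; exists (f ++ fill w a), ((map Some f ++ w, c0) :: [seq (p.1 ++ w, p.2) | p <- L]).
split.
- by rewrite size_cat size_map sf sw.
- by rewrite /= size_map sL.
have E2 : unzip2 [seq (p.1 ++ w, p.2) | p <- L] = unzip2 L.
  by rewrite /unzip2 -map_comp.
split; first by rewrite /= E2 c0L.
move=> l c; rewrite inE => /predU1P[[-> ->]|].
  split; rewrite /is_line ?size_cat ?size_map ?sf ?sw ?eqxx ?mem_cat ?Nw ?orbT //.
    by rewrite fill_cat fill_Some.
  by move=> d ds; rewrite fill_cat fill_Some monow.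
move=> /mapP[[l' c'] /focL[/andP[/eqP sl Nl] la lc] [-> ->]]; split.
- by rewrite /is_line size_cat sl sw eqxx mem_cat Nl.
- by rewrite fill_cat la.
move=> d ds; rewrite fill_cat monow ?lc //.
by rewrite size_map.
Qed.

Lemma hales_jewett_seq (s : seq A) : HJ_property s.
Proof.
elim: s => [|a [|b s] IHs] C.
- by exists 1 => chi; exists [:: None].
- by exists 1 => chi; exists [:: None]; split=> // ? ? /[!inE]/eqP-> /eqP->.
have [n Hn] := focusing a C #|C|.+1 (mem_head b s) IHs; exists n => chi.
have [//|[f [L [_ sL [uL _]]]]] := Hn chi.
by have := max_card [in unzip2 L]; rewrite (card_uniqP uL) size_map sL ltnn.
Qed.

End HalesJewett.

Lemma hales_jewett (A C : finType) : exists n,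
  forall chi : {ffun 'I_n -> A} -> C, exists l : {ffun 'I_n -> option A},
    (exists i, l i = None) /\
    forall a b, chi [ffun i => odflt a (l i)] = chi [ffun i => odflt b (l i)].
Proof.
have [a0 _|A0] := pickP (@predT A); last first.
  exists 1 => chi; exists [ffun=> None]; split; first by exists ord0; rewrite ffunE.
  by move=> a; have := A0 a.
have [n Hn] := hales_jewett_seq (enum A) C; exists n => chi.
have [l [/andP[/eqP sl Nl] mono]] := Hn (fun w => chi [ffun i : 'I_n => nth a0 w i]).
exists [ffun i : 'I_n => nth None l i]; split.
  move: Nl; rewrite -index_mem sl => ltN; exists (Ordinal ltN).
  by rewrite ffunE /= nth_index // -index_mem sl.
have E a : [ffun i : 'I_n => odflt a ([ffun i : 'I_n => nth None l i] i)] =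
           [ffun i : 'I_n => nth a0 (fill l a) i].
  by apply/ffunP => i; rewrite !ffunE (nth_map None) ?sl.
by move=> a b; rewrite !E; apply: mono; rewrite mem_enum.
Qed.

(** * Ramsey's theorem *)

Lemma pigeonhole_seq (T : Type) (C : finType) (g : T -> C) (s : seq T) N :
  #|C| * N < size s -> exists c, N < count (fun x => g x == c) s.
Proof.
move=> lt; apply: contrapT => /forallNP small.
have: size s = \sum_(c : C) count (fun x => g x == c) s.
  elim: s {lt small} => [|x s IH] /=; first by rewrite big1.
  rewrite big_split /= -IH (bigD1 (g x)) //= eqxx big1 // => c /negbTE.
  by rewrite eq_sym => ->.
move=> E; move: lt; rewrite E -sum_nat_const ltnNge leq_sum // => c _.
by rewrite leqNgt; apply/negP/small.
Qed.

(** Keep the head [x], pass to a large color class of its pairs, and repeat; each entry of [s']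
    records the color of its pairs with all later entries. *)
Lemma end_homogeneous_seq (C : finType) m : exists N, forall (T : eqType)
    (s : seq T) (chi : T -> T -> C), N <= size s -> exists s' : seq (T * C),
  [/\ size s' = m, subseq (unzip1 s') s &
      pairwise (fun p q => chi p.1 q.1 == p.2) s'].
Proof.
elim: m => [|m [N IH]].
  by exists 0 => T s chi _; exists [::]; rewrite sub0seq.
exists (#|C| * N).+2 => T [//|x s] chi /= ss.
have [c ltN] := pigeonhole_seq (chi x) ss; set s1 := [seq y <- s | chi x y == c].
have [|s' [ss' sub pw]] := IH T s1 chi; first by rewrite size_filter ltnW.
exists ((x, c) :: s'); split; rewrite /= ?ss' ?eqxx //.
  exact: subseq_trans sub (filter_subseq _ _).
rewrite pw andbT; apply/allP => p ps' /=.
have: p.1 \in s1 by apply: (mem_subseq sub); apply: map_f.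
by rewrite mem_filter => /andP[].
Qed.

Lemma ramsey_seq (C : finType) k : exists N, forall (T : eqType) (s : seq T)
    (chi : T -> T -> C), N <= size s -> exists s' c,
  [/\ size s' = k, subseq s' s & pairwise (fun x y => chi x y == c) s'].
Proof.
have [N HN] := end_homogeneous_seq C (#|C| * k).+1; exists N => T s chi ss.
have [s' [ss' sub pw]] := HN T s chi ss.
have [|c ltk] := @pigeonhole_seq _ _ snd s' k; first by rewrite ss'.
set s1 := [seq p <- s' | p.2 == c].
exists (take k (unzip1 s1)), c; split.
- by rewrite size_takel // size_map size_filter ltnW.
- apply: subseq_trans (take_subseq _ _) (subseq_trans _ sub).
  exact/map_subseq/filter_subseq.
apply: (subseq_pairwise (take_subseq _ _)); rewrite pairwise_map.
have : pairwise (fun p q => (p.2 == c) && (chi p.1 q.1 == p.2)) s1.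
  rewrite pairwise_relI (subseq_pairwise (filter_subseq _ _) pw) andbT.
  have: all (fun p => p.2 == c) s1 by apply: filter_all.
  elim: s1 => //= p s1 IH /andP[pc /IH->]; rewrite andbT.
  by apply/allP => q _.
by apply: sub_pairwise => p q /andP[/eqP<-].
Qed.

Lemma ramsey_increasing (C : finType) k : exists N, forall chi : 'I_N -> 'I_N -> C,
  exists (g : {ffun 'I_k -> 'I_N}) c,
    forall i j : 'I_k, i < j -> g i < g j /\ chi (g i) (g j) = c.
Proof.
have [N HN] := ramsey_seq C k; exists N => chi.
have [|s [c [ss sub pw]]] := HN _ (enum 'I_N) chi; first by rewrite size_enum_ord.
have srt : pairwise (fun x y : 'I_N => x < y) s.
  apply: (subseq_pairwise sub).
  rewrite -(pairwise_map val ltn) val_enum_ord.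
  by rewrite -sorted_pairwise ?iota_ltn_sorted //; apply: ltn_trans.
pose t : k.-tuple 'I_N := Tuple (introT eqP ss).
exists [ffun i => tnth t i], c => i j ij; rewrite !ffunE.
pose x0 := tnth t i.
have is_h (h : 'I_k) : val h \in gtn (size s) by rewrite -topredE /= ss ltn_ord.
rewrite !(tnth_nth x0); split.
  by move/(pairwiseP x0): srt => /(_ i j (is_h i) (is_h j) ij).
by move/(pairwiseP x0): pw => /(_ i j (is_h i) (is_h j) ij)/eqP.
Qed.

(** * The partite construction *)

Definition cliques_le k (V : finType) (e : rel V) :=
  forall K : {set V}, {in K &, forall x y, x != y -> e x y} -> #|K| <= k.

(* For every k-tuple [g] of distinct parts there is a k-clique in these parts; [S] lists
   the pairs of parts for which the color of its edges is already determined by the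
   parts, uniformly in [g]. *)
Definition partite_ramsey k N (C : finType) (S : seq ('I_N * 'I_N)) (V : finType)
    (e : rel V) (part : V -> 'I_N) :=
  [/\ symmetric e, forall x y, e x y -> part x != part y, cliques_le k e &
   forall col : V -> V -> C, exists gam : 'I_N -> 'I_N -> C,
     forall g : {ffun 'I_k -> 'I_N}, injective g -> exists phi : 'I_k -> V,
       (forall i, part (phi i) = g i) /\
       forall i j, i != j -> e (phi i) (phi j) /\
         ((g i, g j) \in S -> col (phi i) (phi j) = gam (g i) (g j))].

(** A disjoint union of graphs on [k] vertices, one for each tuple [g], complete when [g] is
    injective. A clique fixes [g], so it has at most one vertex for each index. *)
Lemma partite_base k N (C : finType) : 0 < #|C| -> exists V e part,
  @partite_ramsey k N C [::] V e part.
Proof.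
move=> /card_gt0P[c0 _].
pose V : finType := ({ffun 'I_k -> 'I_N} * 'I_k)%type.
exists V, (fun x y : V => (x.1 == y.1) && (x.1 x.2 != x.1 y.2)).
exists (fun x : V => x.1 x.2); split.
- move=> [g i] [h j] /=; rewrite [h == g]eq_sym.
  by case: eqP => // ->; rewrite eq_sym.
- by move=> [g i] [h j] /= /andP[/eqP<-].
- move=> K clK; rewrite -[k in _ <= k]card_ord -(@card_in_imset _ _ snd K).
    exact: max_card.
  move=> [g i] [h j] xK yK /= ij; apply/eqP/negPn/negP => ne.
  by have /= := clK _ _ xK yK ne; rewrite ij eqxx andbF.
move=> col; exists (fun _ _ => c0) => g injg; exists (fun i => (g, i)).
by split=> // i j ij; rewrite /= eqxx (inj_eq injg).
Qed.

Section PartiteStep.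
Variables (k N : nat) (C V : finType) (e : rel V) (part : V -> 'I_N).
Variables (u v : 'I_N).
Hypothesis uv : u != v.
Hypothesis esym : symmetric e.
Hypothesis epart : forall x y, e x y -> part x != part y.

(* Each combinatorial line over the alphabet of edges between the parts [u] and [v]
   carries a copy of the graph; two copies meet only in vertices of the new parts [u] and
   [v], which are words of length [n].  Every copy is induced, hence a clique using a
   vertex outside these two parts lies in a single copy. *)
Definition edge_uv := {x : V * V | [&& e x.1 x.2, part x.1 == u & part x.2 == v]}.

Variable n : nat.
Let line := {l : {ffun 'I_n -> option edge_uv} | [exists i, l i == None]}.
Let V' := ('I_N * {ffun 'I_n -> V} + line * V)%type.

Let end1 (l : line) x : {ffun 'I_n -> V} :=
  [ffun i => if val l i is Some p then (val p).1 else x].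
Let end2 (l : line) x : {ffun 'I_n -> V} :=
  [ffun i => if val l i is Some p then (val p).2 else x].

Definition copy (l : line) (x : V) : V' :=
  if part x == u then inl (u, end1 l x)
  else if part x == v then inl (v, end2 l x) else inr (l, x).

Definition part_amalgam (x : V') : 'I_N :=
  match x with inl p => p.1 | inr p => part p.2 end.

Definition amalgam (a b : V') :=
  [exists l : line, exists x, exists y, [&& e x y, a == copy l x & b == copy l y]].

Lemma amalgamP a b : reflect (exists l x y, [/\ e x y, a = copy l x & b = copy l y]) (amalgam a b).
Proof.
apply: (iffP existsP) => [[l /existsP[x /existsP[y /and3P[exy /eqP-> /eqP->]]]]|].
  by exists l, x, y.
move=> [l [x [y [exy -> ->]]]]; exists l; apply/existsP; exists x.
by apply/existsP; exists y; rewrite exy !eqxx.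
Qed.

Lemma part_copy l x : part_amalgam (copy l x) = part x.
Proof. by rewrite /copy; case: eqP => [->|_] //; case: eqP => [->|]. Qed.

Lemma copy_inj l : injective (copy l).
Proof.
move=> x y E; have:= part_copy l x; rewrite E part_copy => pxy.
have /existsP[i /eqP li] := valP l.
move: E; rewrite /copy pxy; case: eqP => _; last case: eqP => _; last by case.
  by case=> /ffunP/(_ i); rewrite !ffunE li.
by case=> /ffunP/(_ i); rewrite !ffunE li.
Qed.

(** An end outside the parts [u] and [v] determines the line. If both ends are words, they show [x]
    and [y] at a wildcard [i] of [l]; being ends of an edge of the copy along [l'], they show there
    an edge of [e], whether [l' i] is a wildcard or a fixed edge. *)
Lemma copy_e l x y : amalgam (copy l x) (copy l y) = e x y.
Proof.
apply/amalgamP/idP => [[l' [x' [y' [exy xE yE]]]]|exy]; last by exists l, x, y.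
have px : part x' = part x by rewrite -(part_copy l') -xE part_copy.
have py : part y' = part y by rewrite -(part_copy l') -yE part_copy.
have same : l' = l -> e x y.
  by move=> ll; move: xE yE; rewrite ll => /copy_inj-> /copy_inj->.
have [i /eqP li] := existsP (valP l).
have := epart exy; rewrite px py => pxy.
move: xE yE; rewrite /copy px py.
case: (eqVneq (part x) u) pxy => [xu|xNu] pxy; last first.
  case: (eqVneq (part x) v) pxy => [xv|xNv] pxy; last first.
    by case=> ll _ _; apply: same.
  case: (eqVneq (part y) u) pxy => [yu|yNu] pxy; last first.
    have -> : (part y == v) = false by rewrite -xv eq_sym (negbTE pxy).
    by move=> _ [ll _]; apply: same.
  case=> /ffunP/(_ i) + [/ffunP/(_ i)]; rewrite !ffunE li.
  case: (val l' i) => [[[p q] /= /and3P[epq _ _]]|]; last by move=> -> ->.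
  by move=> -> ->; rewrite esym.
have -> : (part y == u) = false by rewrite -xu eq_sym (negbTE pxy).
case: (eqVneq (part y) v) => [yv|yNv]; last by move=> _ [ll _]; apply: same.
case=> /ffunP/(_ i) + [/ffunP/(_ i)]; rewrite !ffunE li.
by case: (val l' i) => [[[p q] /= /and3P[epq _ _]]|]; move=> -> ->.
Qed.

Lemma amalgam_sym : symmetric amalgam.
Proof.
by move=> a b; apply/amalgamP/amalgamP => -[l [x [y [exy -> ->]]]]; exists l, y, x; rewrite esym.
Qed.

Lemma amalgam_part a b : amalgam a b -> part_amalgam a != part_amalgam b.
Proof. by move=> /amalgamP[l [x [y [exy -> ->]]]]; rewrite !part_copy epart. Qed.

Lemma amalgam_inr l x b : amalgam (inr (l, x)) b ->
  inr (l, x) = copy l x /\ exists y, b = copy l y.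
Proof.
move=> /amalgamP[l' [x' [y [_ + ->]]]]; rewrite {1}/copy.
case: ifP => // xu; case: ifP => // xv [-> ->].
by split; [rewrite /copy xu xv | exists y].
Qed.

Lemma amalgam_inl i t b : amalgam (inl (i, t)) b -> i \in [:: u; v].
Proof.
move=> /amalgamP[l' [x' [y [_ + _]]]]; rewrite /copy !inE.
case: ifP => _; first by case=> -> _; rewrite eqxx.
by case: ifP => _ // [-> _]; rewrite eqxx orbT.
Qed.

Lemma cliques_amalgam : 2 <= k -> cliques_le k e -> cliques_le k amalgam.
Proof.
move=> k2 cle K clK.
have [K1|K2] := leqP #|K| 1; first exact: leq_trans K1 (ltnW k2).
have other a : a \in K -> exists2 b, b \in K & a != b.
  move=> aK; have /card_gt0P[b] : 0 < #|K :\ a| by move: K2; rewrite (cardsD1 a) aK.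
  by rewrite !inE eq_sym => /andP[ba bK]; exists b.
have [[l x] lxK|no] := pickP [pred p : line * V | inr p \in K].
  have im a : a \in K -> a \in codom (copy l).
    move=> aK; have [<-|/(clK _ _ lxK aK)/amalgam_inr[_ [y ->]]] := eqVneq (inr (l, x)) a.
      have [b bK /(clK _ _ lxK bK)/amalgam_inr[-> _]] := other _ lxK; exact: codom_f.
    exact: codom_f.
  have -> : K = copy l @: (copy l @^-1: K).
    apply/setP => a; apply/idP/imsetP => [aK|[x' + ->]]; last by rewrite inE.
    by have /codomP[y ya] := im a aK; exists y => //; rewrite inE -ya.
  rewrite card_imset; last exact: copy_inj.
  apply: cle => y z; rewrite !inE => yK zK yz; rewrite -(copy_e l).
  by apply: clK => //; rewrite (inj_eq (@copy_inj l)).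
apply: leq_trans k2; rewrite -(@card_in_imset _ _ part_amalgam K); last first.
  move=> a b aK bK ab; apply/eqP/negPn/negP => ne.
  by have := amalgam_part (clK _ _ aK bK ne); rewrite ab eqxx.
apply: leq_trans (_ : #|[set u; v]| <= _); last by rewrite cards2 ltnS leq_b1.
apply/subset_leq_card/subsetP => _ /imsetP[a aK ->].
have [b bK /(clK _ _ aK bK)] := other a aK.
case: a aK => [[i t] _ /amalgam_inl|p pK]; first by rewrite !inE.
by have := no p; rewrite /= pK.
Qed.

(** On the copy along a monochromatic line, all edges between [u] and [v] have one color [c]; the
    property for [S], applied inside this copy, settles the pairs in [S]. *)
Lemma partite_ramsey_amalgam S :
  (forall chi : {ffun 'I_n -> edge_uv} -> C, exists l : {ffun 'I_n -> option edge_uv},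
    (exists i, l i = None) /\
    forall a b, chi [ffun i => odflt a (l i)] = chi [ffun i => odflt b (l i)]) ->
  2 <= k -> 0 < #|C| ->
  partite_ramsey k C S e part -> partite_ramsey k C ((u, v) :: S) amalgam part_amalgam.
Proof.
move=> HJ k2 /card_gt0P[c0 _] [_ _ cle ram].
split; [exact: amalgam_sym | exact: amalgam_part | exact: cliques_amalgam | move=> col].
pose chi (w : {ffun 'I_n -> edge_uv}) :=
  col (inl (u, [ffun i => (val (w i)).1])) (inl (v, [ffun i => (val (w i)).2])).
have [l0 [l0N mono]] := HJ chi.
have lP : [exists i, l0 i == None].
  by have [i li] := l0N; apply/existsP; exists i; rewrite li.
pose l : line := exist _ l0 lP.
have {mono}[c cE] : exists c, forall x y, e x y -> part x = u -> part y = v ->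
    col (copy l x) (copy l y) = c.
  have chiE x y (exy : [&& e x y, part x == u & part y == v]) :
      col (copy l x) (copy l y) =
      chi [ffun i => odflt (exist _ (x, y) exy : edge_uv) (l0 i)].
    have /and3P[_ /eqP xu /eqP yv] := exy.
    rewrite /copy xu yv !eqxx eq_sym (negbTE uv) /chi.
    by congr col; congr (inl (_, _)); apply/ffunP => i; rewrite !ffunE /=; case: (l0 i).
  have [a _|no] := pickP (@predT edge_uv).
    exists (chi [ffun i => odflt a (l0 i)]) => x y exy xu yv.
    have xyP : [&& e x y, part x == u & part y == v] by rewrite exy xu yv !eqxx.
    by rewrite (chiE x y xyP); apply: mono.
  exists c0 => x y exy xu yv.
  have xyP : [&& e x y, part x == u & part y == v] by rewrite exy xu yv !eqxx.
  by have := no (exist _ (x, y) xyP).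
have [gam gamP] := ram (fun x y => col (copy l x) (copy l y)).
exists (fun i j => if (i, j) == (u, v) then c else gam i j) => g injg.
have [phi [phip phiE]] := gamP g injg; exists (fun i => copy l (phi i)); split.
  by move=> i; rewrite part_copy.
move=> i j ij; have [exy cxy] := phiE i j ij; rewrite copy_e; split=> //.
rewrite inE; case: eqVneq => [[gi gj] _|_]; last exact: cxy.
by apply: cE; rewrite // phip.
Qed.

End PartiteStep.

Lemma partite_ramsey_exists k N (C : finType) (S : seq ('I_N * 'I_N)) :
  2 <= k -> 0 < #|C| -> all (fun p => p.1 != p.2) S ->
  exists V e part, @partite_ramsey k N C S V e part.
Proof.
move=> k2 C0; elim: S => [_|[u v] S IH /= /andP[uv /IH[V [e [part P]]]]].
  exact: partite_base.
have [n HJ] := hales_jewett (edge_uv e part u v) C.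
have [esym epart _ _] := P.
by do 3 eexists; apply: (partite_ramsey_amalgam uv esym epart HJ k2 C0 P).
Qed.

(** With all pairs of distinct parts in [S], the colors on the cliques provided depend only on the
    parts, so Ramsey's theorem for [gam] on the parts yields [g]. *)
Lemma folkman_clique k (C : finType) : 2 <= k -> 0 < #|C| ->
  exists (V : finType) (e : rel V), [/\ symmetric e, irreflexive e, cliques_le k e &
    forall col : V -> V -> C, exists (h : 'I_k -> V) c,
      forall i j : 'I_k, i < j -> e (h i) (h j) /\ col (h i) (h j) = c].
Proof.
move=> k2 C0; have [N HN] := ramsey_increasing C k.
pose S := [seq p <- enum {: 'I_N * 'I_N} | p.1 != p.2].
have [|V [e [part [esym epart cle ram]]]] := @partite_ramsey_exists k N C S k2 C0.
  exact: filter_all.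
exists V, e; split=> //.
  by move=> x; apply/negP => /epart; rewrite eqxx.
move=> col; have [gam gamP] := ram col; have [g [c gE]] := HN gam.
have injg : injective g.
  move=> i j gij; apply/val_inj; case: (ltngtP i j) => // /gE[].
    by rewrite gij ltnn.
  by rewrite gij ltnn.
have [phi [_ phiE]] := gamP g injg; exists phi, c => i j ij.
have [lt <-] := gE i j ij.
have [|exy colE] := phiE i j; first by rewrite -val_eqE /= ltn_eqF.
split=> //; apply: colE.
by rewrite mem_filter mem_enum /= -val_eqE /= ltn_eqF.
Qed.

(** * Lower dense pairs *)

Section LowerDense.
Variable T : finType.
Implicit Types (e : rel T) (A B X Y : {set T}).

Definition nbrs e x Y := [set y in Y | e x y].

Definition low_degree q e X Y := [set x in X | q * #|nbrs e x Y| < #|Y|].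

(** [K] controls both the relative size of the tested sets [Y] and the proportion of exceptional
    vertices in [A]; [1 / q] is the density. *)
Definition lower_dense K q e A B := forall Y, Y \subset B ->
  #|B| <= K * #|Y| -> K * #|low_degree q e A Y| < #|A|.

Lemma lower_dense_sub K M q e A B A' B' :
  A' \subset A -> B' \subset B -> #|A| <= M * #|A'| -> #|B| <= M * #|B'| ->
  lower_dense (K * M) q e A B -> lower_dense K q e A' B'.
Proof.
move=> sA sB cA cB dAB Y sY cY.
have lo : #|low_degree q e A' Y| <= #|low_degree q e A Y|.
  apply/subset_leq_card/subsetP => x; rewrite !inE => /andP[xA ->].
  by rewrite (subsetP sA).
have cY' : #|B| <= K * M * #|Y|.
  by apply: leq_trans cB _; rewrite mulnAC mulnC leq_mul2r cY orbT.
have lt := dAB Y (subset_trans sY sB) cY'.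
rewrite ltnNge; apply/negP => ge.
have : M * #|A'| <= M * (K * #|low_degree q e A Y|).
  by rewrite leq_mul2l (leq_trans ge) ?orbT // leq_mul2l lo orbT.
lia.
Qed.

(* Density increment: if (X, Y) witnesses a failure, then the minimum relative degree
   (2K + t) / (2Kr) into B rises by at least 1 / (2Kr) on passing to (X, B \ Y); it never
   exceeds 1, so t < 2Kr. *)
Lemma lower_dense_pair_mindeg K r e s t A B :
  0 < K -> 0 < r -> t + s = 2 * K * r -> 0 < #|A| -> 0 < #|B| ->
  (forall x, x \in A -> (2 * K + t) * #|B| <= 2 * K * r * #|nbrs e x B|) ->
  exists A' B', [/\ A' \subset A, B' \subset B,
    #|A| <= (2 * K * r) ^ s * #|A'|, #|B| <= (2 * K * r) ^ s * #|B'| &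
    lower_dense K (2 * r) e A' B'].
Proof.
move=> K0 r0; elim: s t A B => [|s IH] t A B ts A0 B0 deg.
  (* Here [t = 2 * K * r], so [x] would have more than [#|B|] neighbors in [B]. *)
  have [x xA] := card_gt0P A0; have := deg x xA.
  have : #|nbrs e x B| <= #|B| by apply/subset_leq_card/subsetP => y /[!inE]/andP[].
  nia.
have [dAB|/existsNP[Y /not_implyP[sY /not_implyP[cY /negP]]]] :=
  pselect (lower_dense K (2 * r) e A B).
  have M1 : 0 < (2 * K * r) ^ s.+1 by rewrite expn_gt0; lia.
  by exists A, B; split=> //; rewrite leq_pmull.
rewrite -leqNgt; set X := low_degree _ _ _ _ => cX.
have sX : X \subset A by apply/subsetP => x /[!inE]/andP[].
have X0 : 0 < #|X| by nia.
have cB : #|B| = #|Y| + #|B :\: Y|.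
  by rewrite -(cardsID Y B) (setIidPr sY).
have degX x : x \in X -> [/\ 2 * r * #|nbrs e x Y| < #|Y|,
    (2 * K + t) * #|B| <= 2 * K * r * #|nbrs e x B|,
    #|nbrs e x B| = #|nbrs e x Y| + #|nbrs e x (B :\: Y)| &
    #|nbrs e x (B :\: Y)| <= #|B :\: Y|].
  rewrite inE => /andP[xA lo]; split=> //; first exact: deg.
    rewrite -(cardsID Y (nbrs e x B)); congr (_ + _); apply: eq_card => y.
      rewrite !inE; case yY: (y \in Y); rewrite ?andbF // (subsetP sY) //.
      by rewrite andbT.
    by rewrite !inE andbA.
  by apply/subset_leq_card/subsetP => y /[!inE]/andP[].
(* At least [#|B| / r] neighbors in [B], fewer than [#|B| / (2 * r)] of them in [Y], leave more than
   [#|B| / (2 * r)] outside [Y]. *)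
have BY : #|B| <= 2 * r * #|B :\: Y|.
  have [x xX] := card_gt0P X0; have [h1 h2 h3 h4] := degX x xX.
  have h5 : #|B| <= r * #|nbrs e x B| by nia.
  nia.
have [|||x xX|A' [B' [sA' sB' cA' cB' d]]] := IH t.+1 X (B :\: Y).
- lia.
- exact: X0.
- nia.
(* Removing [Y] costs at most [K * #|Y|] on the right and saves [(2 * K + t) * #|Y|] on the left;
   the surplus, at least [K * #|Y| >= #|B|], pays for the increment. *)
- have [h1 h2 h3 h4] := degX x xX; nia.
exists A', B'; split => //.
- exact: subset_trans sX.
- exact: subset_trans sB' (subsetDl _ _).
- rewrite expnS; nia.
- rewrite expnS; nia.
Qed.

Lemma pigeonhole_set (C : finType) (f : T -> C) X : 0 < #|X| ->
  exists c, #|X| <= #|C| * #|[set x in X | f x == c]|.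
Proof.
move=> X0; apply: contrapT => /forallNP small.
have E : #|X| = \sum_(c : C) #|[set x in X | f x == c]|.
  rewrite -sum1_card (partition_big f predT) //=; apply: eq_bigr => c _.
  by rewrite -sum1_card; apply: eq_bigl => x; rewrite inE.
have : #|C| * \sum_(c : C) #|[set x in X | f x == c]| < #|C| * #|X|.
  rewrite big_distrr /= -sum_nat_const.
  have [x xX] := card_gt0P X0.
  rewrite (bigD1 (f x)) //= [ltnRHS](bigD1 (f x)) //= -addSn leq_add //.
    by rewrite ltnNge; apply/negP/small.
  by apply: leq_sum => c _; rewrite leqNgt; apply/negP => /ltnW/small.
by rewrite -E ltnn.
Qed.

(** Each [x] chooses a color it has to at least [#|B| / r] vertices of [B]; the vertices of [A] with
    a common choice [c] form the case [t = 0] of the density increment. *)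
Lemma lower_dense_pair (C : finType) (chi : T -> T -> C) K A B :
  0 < K -> 0 < #|A| -> 0 < #|B| ->
  let r := #|C| in let M := r * (2 * K * r) ^ (2 * K * r) in
  exists c A' B', [/\ A' \subset A, B' \subset B,
    #|A| <= M * #|A'|, #|B| <= M * #|B'| &
    lower_dense K (2 * r) (fun x y => chi x y == c) A' B'].
Proof.
move=> K0 A0 B0 r M.
have [x0 x0A] := card_gt0P A0.
have r0 : 0 < r by apply/card_gt0P; exists (chi x0 x0).
have [f fP] := choice (fun x => pigeonhole_set (chi x) B0).
have [c cA] := pigeonhole_set f A0.
set A1 := [set x in A | _] in cA.
have sA1 : A1 \subset A by apply/subsetP => x /[!inE]/andP[].
have [|||x|A' [B' [sA sB cA' cB d]]] := @lower_dense_pair_mindeg K r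
  (fun x y => chi x y == c) (2 * K * r) 0 A1 B K0 r0.
- by [].
- nia.
- exact: B0.
- rewrite inE => /andP[xA /eqP <-]; have := fP x.
  rewrite /nbrs; nia.
exists c, A', B'; split=> //.
- exact: subset_trans sA1.
- by rewrite /M; nia.
- by rewrite /M; nia.
Qed.

End LowerDense.

(** The first pair is made lower dense with parameter [K * M], where [M] is the shrinking factor of
    the remaining pairs, so that parameter [K] survives their treatment. *)
Lemma lower_dense_family (I C : finType) (L : seq (I * I)) K :
  0 < K -> 0 < #|C| -> all (fun p => p.1 != p.2) L -> exists M, 0 < M /\
  forall (T : finType) (chi : T -> T -> C) (A : I -> {set T}),
    (forall i, 0 < #|A i|) -> exists A' : I -> {set T},
      (forall i, A' i \subset A i /\ #|A i| <= M * #|A' i|) /\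
      forall p, p \in L -> exists c,
        lower_dense K (2 * #|C|) (fun x y => chi x y == c) (A' p.1) (A' p.2).
Proof.
move=> K0 C0; elim: L => [_|[i j] L IH /= /andP[ij /IH[M [M0 HM]]]].
  exists 1; split=> // T chi A A0; exists A; split=> // i.
  by rewrite mul1n.
set M1 := #|C| * (2 * (K * M) * #|C|) ^ (2 * (K * M) * #|C|).
have M10 : 0 < M1 by rewrite muln_gt0 C0 expn_gt0; nia.
exists (M * M1); split; first by rewrite muln_gt0 M0.
move=> T chi A A0.
have [|||c [X [Y [sX sY cX cY d]]]] := @lower_dense_pair T C chi (K * M) (A i) (A j).
- by rewrite muln_gt0 K0.
- exact: A0.
- exact: A0.
rewrite -/M1 in cX cY.
pose A1 k := if k == i then X else if k == j then Y else A k.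
have A1P k : A1 k \subset A k /\ #|A k| <= M1 * #|A1 k|.
  rewrite /A1; case: eqP => [->|_]; first by rewrite sX cX.
  case: eqP => [->|_]; first by rewrite sY cY.
  by rewrite subxx leq_pmull.
have [|A' [A'P dA']] := HM T chi A1.
  by move=> k; have [_] := A1P k; have := A0 k; nia.
exists A'; split.
  move=> k; have [s1 c1] := A1P k; have [s2 c2] := A'P k.
  split; [exact: subset_trans s2 s1 | nia].
move=> p; rewrite inE => /predU1P[->|]; last exact: dA'.
exists c; move: d.
have [] := A'P i; have [] := A'P j.
rewrite /A1 eqxx (negbTE (_ : j != i)) 1?eq_sym // eqxx => sj cj si ci.
exact: lower_dense_sub.
Qed.

(** * Embedding bounded degree graphs *)

Lemma greedy_coloring (G : finType) (g : rel G) D :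
  symmetric g -> irreflexive g -> (forall x, #|[set y | g x y]| <= D) ->
  exists kap : G -> 'I_D.+1, forall x y, g x y -> kap x != kap y.
Proof.
move=> gsym girr deg.
suff [kap kapP] : exists kap : G -> 'I_D.+1,
    {in enum G &, forall x y, g x y -> kap x != kap y}.
  by exists kap => x y; apply: kapP; rewrite mem_enum.
elim: (enum G) => [|z s [kap kapP]]; first by exists (fun=> ord0).
have [c cN] : exists c, c \notin kap @: [set y | g z y].
  apply/existsP; rewrite -negb_forall; apply/negP => /forallP all.
  have : #|kap @: [set y | g z y]| = D.+1.
    by rewrite -[RHS]card_ord; apply: eq_card => c; rewrite all.
  by have := leq_trans (leq_imset_card kap _) (deg z) => /[swap] ->; rewrite ltnn.
have ck y : g z y -> c != kap y.
  by move=> gzy; apply: contraNneq cN => ->; apply: imset_f; rewrite inE.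
exists (fun x => if x == z then c else kap x) => x y.
rewrite !inE; case: (eqVneq x z) => [->|xz]; case: (eqVneq y z) => [->|yz] //=.
- by rewrite girr.
- by move=> _ _; apply: ck.
- by move=> _ _; rewrite gsym eq_sym; apply: ck.
- exact: kapP.
Qed.

Section Embedding.
Variables (T G : finType) (e : rel T) (g : rel G) (D k q : nat).
Variables (kap : G -> 'I_k) (U : 'I_k -> {set T}).
Hypothesis q0 : 0 < q.
Hypothesis gsym : symmetric g.
Hypothesis deg : forall x, #|[set y | g x y]| <= D.
Hypothesis kapP : forall x y, g x y -> kap x != kap y.
Hypothesis dense : forall i j : 'I_k, i < j ->
  lower_dense (2 * D.+1 * q ^ D) q e (U i) (U j).
Hypothesis large : forall i, 2 * q ^ D * #|G| <= #|U i|.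

Definition degree_in (s : seq G) x := #|[set z in s | g x z]|.

Lemma degree_in_le s x : degree_in s x <= D.
Proof.
by apply: leq_trans (deg x); apply/subset_leq_card/subsetP => z /[!inE]/andP[].
Qed.

(* [cand y] contains the images of [y] that are still compatible with the images
   of the neighbours of [y] outside [s]; each of these cost at most a factor [q]. *)
Lemma embed_seq (s : seq G) (cand : G -> {set T}) (W : {set T}) :
  uniq s -> pairwise (fun x y => kap x <= kap y) s -> #|W| + size s <= #|G| ->
  (forall y, y \in s -> cand y \subset U (kap y) /\
     #|U (kap y)| <= q ^ (D - degree_in s y) * #|cand y|) ->
  exists f : G -> T, [/\ {in s, forall y, f y \in cand y :\: W},
    {in s &, injective f} &
    {in s &, forall y z, g y z -> kap y < kap z -> e (f y) (f z)}].
Proof.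
elim: s cand W => [|y s IH] cand W.
  move=> _ _ _ _; suff /choice[f _] : forall x : G, exists v, v \in U (kap x) by exists f.
  move=> x; apply/card_gt0P; apply: leq_trans (large _).
  by rewrite !muln_gt0 expn_gt0 q0; apply/card_gt0P; exists x.
move=> /= /andP[ys us] /andP[/allP srt pw] cW candP.
have [sy cy] := candP y (mem_head y s).
set Uy := U (kap y) in sy cy.
have qD0 : 0 < q ^ D by rewrite expn_gt0 q0.
have qle m : q ^ (D - m) <= q ^ D by rewrite leq_pexp2l ?leq_subr.
pose Z := [set z in s | g y z].
have ZD : #|Z| <= D by apply: degree_in_le.
(* Images of [y] that would leave less than a [1 / q] fraction of the candidates of a later neighbor
   [z]. *)
pose bad z := low_degree q e Uy (cand z).
have badP z : z \in Z -> 2 * D.+1 * q ^ D * #|bad z| <= #|Uy|.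
  rewrite inE => /andP[zs gyz]; apply: ltnW; apply: (@dense _ (kap z)).
  - by rewrite ltn_neqAle kapP //= srt.
  - by have [] := candP z; rewrite // inE zs orbT.
  have [_ cz] := candP z (mem_behead (s := y :: s) zs).
  apply: leq_trans cz _; rewrite leq_mul2r.
  by rewrite (leq_trans (qle _)) ?orbT // leq_pmull.
have badU : 2 * D.+1 * q ^ D * #|\bigcup_(z in Z) bad z| <= D * #|Uy|.
  apply: (@leq_trans (2 * D.+1 * q ^ D * \sum_(z in Z) #|bad z|)).
    rewrite leq_mul2l; apply/orP; right.
    elim/big_ind2: _ => [|a b c d ab cd|//]; first by rewrite cards0.
    by apply: leq_trans (leq_card_setU _ _) _; apply: leq_add.
  rewrite big_distrr /=; apply: leq_trans (leq_sum _ badP) _; rewrite sum_nat_const.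
  by rewrite leq_mul2r ZD orbT.
have cardU : 2 * q ^ D * #|G| <= #|Uy| by apply: large.
(* [cand y] has at least [#|Uy| / q ^ D] elements. Fewer than half of this number lie in [W], since
   [#|W| < #|G|], and the at most [D] bad sets together cover at most the fraction [D / (2 * D.+1)]
   of it. *)
have [v] : exists v, v \in cand y :\: (W :|: \bigcup_(z in Z) bad z).
  apply/card_gt0P; rewrite cardsD subn_gt0.
  apply: leq_ltn_trans (subset_leq_card (subsetIr _ _)) _.
  apply: leq_ltn_trans (leq_card_setU _ _) _.
  have cy' : #|Uy| <= q ^ D * #|cand y|.
    by apply: leq_trans cy _; rewrite leq_mul2r qle orbT.
  move: badU cW cardU cy' qD0; set b := #|\bigcup_(_ in _) _|.
  move: (q ^ D) => Q badU cW cardU cy' Q0.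
  rewrite ltnNge; apply/negP => ge.
  have h1 : 2 * D.+1 * Q * #|cand y| <= 2 * D.+1 * Q * (#|W| + b)
    by rewrite leq_mul2l ge orbT.
  have h2 : 2 * D.+1 * #|Uy| <= 2 * D.+1 * (Q * #|cand y|)
    by rewrite leq_mul2l cy' orbT.
  have h3 : D.+1 * (2 * Q * #|G|) <= D.+1 * #|Uy|
    by rewrite leq_mul2l cardU orbT.
  have h4 : 2 * D.+1 * Q * (#|W| + 1) <= 2 * D.+1 * Q * #|G|
    by rewrite leq_mul2l (leq_trans _ cW) ?orbT // leq_add2l.
  have h5 : 0 < D.+1 * Q by rewrite muln_gt0 Q0.
  nia.
rewrite !inE negb_or => /andP[/andP[vW /bigcupP vbad] vy].
have vU : v \in Uy by apply: (subsetP sy).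
pose cand' z := if g y z then nbrs e v (cand z) else cand z.
have sub' z : cand' z \subset cand z.
  by rewrite /cand'; case: ifP => // _; apply/subsetP => x /[!inE]/andP[].
have [||f [fc finj fe]] := IH cand' (v |: W) us pw.
- by rewrite cardsU1 vW add1n addSnnS.
- move=> z zs; have [sz cz] := candP z (mem_behead (s := y :: s) zs).
  split; first exact: subset_trans (sub' z) sz.
  apply: leq_trans cz _; have := degree_in_le (y :: s) z.
  (* Embedding [y] lowers the remaining degree of a neighbor [z] by one, which accounts for the
     factor [q] lost in [cand' z]. *)
  have -> : degree_in (y :: s) z = g y z + degree_in s z.
    rewrite /degree_in (cardsD1 y) !inE eqxx gsym; congr (_ + _).
    apply: eq_card => w; rewrite !inE.
    by case: eqVneq => //= ->; rewrite (negbTE ys).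
  rewrite /cand'; case: ifP => [gyz|_]; rewrite ?leqnn //= => lt.
  have : #|cand z| <= q * #|nbrs e v (cand z)|.
    rewrite leqNgt; apply/negP => low; apply: vbad; exists z; rewrite !inE ?zs //.
    by rewrite -/Uy vU.
  have -> : D - degree_in s z = (D - (true + degree_in s z)).+1 by lia.
  by rewrite expnSr -mulnA leq_mul2l => ->; rewrite orbT.
exists (fun x => if x == y then v else f x).
have ny z : z \in s -> z == y = false.
  by move=> zs; apply: contraNF ys => /eqP<-.
have fz z : z \in s -> [/\ f z \in cand' z, f z != v & f z \notin W].
  by move=> /fc; rewrite !inE negb_or => /andP[/andP[]].
split.
- move=> z; rewrite inE => /predU1P[->|zs]; first by rewrite eqxx inE vW.
  have [c1 _ c2] := fz z zs; rewrite ny // inE c2.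
  exact: (subsetP (sub' z)).
- move=> z w; rewrite !inE => /predU1P[->|zs] /predU1P[->|ws] //.
  + by rewrite eqxx ny //; have [_ /eqP + _] := fz w ws => /[swap] ->.
  + by rewrite eqxx ny //; have [_ /eqP + _] := fz z zs => /[swap] ->.
  + by rewrite !ny //; apply: finj.
move=> z w; rewrite !inE => /predU1P[->|zs] /predU1P[->|ws].
- by rewrite ltnn.
- rewrite eqxx ny // => gyw _; have [] := fz w ws.
  by rewrite /cand' gyw inE => /andP[].
- by move=> _; rewrite ltnNge srt.
- by rewrite !ny //; apply: fe.
Qed.

Lemma embed_dense : exists f : G -> T, [/\ injective f,
  forall y, f y \in U (kap y) & forall y z, g y z -> kap y < kap z -> e (f y) (f z)].
Proof.
pose lek : rel G := fun x y => kap x <= kap y.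
(* In this order the neighbors still to be embedded lie in higher classes, the direction in which
   [dense] holds. *)
pose s := sort lek (enum G).
have ms y : y \in s by rewrite mem_sort mem_enum.
have [||||f [fU finj fe]] := @embed_seq s (fun y => U (kap y)) set0.
- by rewrite sort_uniq enum_uniq.
- rewrite -sorted_pairwise; last by move=> ? ? ?; apply: leq_trans.
  by apply: sort_sorted => x y; apply: leq_total.
- by rewrite cards0 size_sort -cardE.
- by move=> y _; split=> //; rewrite leq_pmull // expn_gt0 q0.
exists f; split=> [y z|y|y z].
- exact: finj.
- by have := fU y (ms y); rewrite !inE.
- exact: fe.
Qed.

End Embedding.

(** * Least numbers and the inequality Delta < p *)

Lemma smallest_le (P : nat -> Prop) N :
  P N -> exists2 m, smallest P = Some m & m <= N.
Proof.
move=> PN; rewrite /smallest; case: pselect => [exP|[]]; last first.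
  by exists N; apply/asboolP.
by exists (ex_minn exP) => //; case: ex_minnP => m _; apply; apply/asboolP.
Qed.

Lemma smallest_Some (P : nat -> Prop) m : smallest P = Some m -> P m.
Proof.
rewrite /smallest; case: pselect => // exP [<-].
by case: ex_minnP => n /asboolP.
Qed.

(* If p = d, color the edge {0, 1} differently from all other edges. *)
Lemma arrows_complete_gt r d p : 3 <= d -> 2 <= r ->
  arrows r (complete p) (complete d) -> d < p.
Proof.
move=> d3 r2 arr; rewrite ltnNge; apply/negP => pd.
pose c0 : 'I_r := Ordinal (ltnW r2); pose c1 : 'I_r := Ordinal r2.
have [c [f [finj fE]]] :=
  arr (fun A => if [forall x in A, (x : 'I_p) <= 1] then c0 else c1).
have dp : d <= p by have := leq_card f finj; rewrite !card_ord.
have {dp}pd' : p = d by apply/eqP; rewrite eqn_leq pd.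
subst p.
(* The copy is spanning, so every edge of [complete p] has color [c]. *)
have [f1 _ fK] : bijective (f : 'I_d -> 'I_d) by apply: injF_bij.
pose a0 : 'I_d := Ordinal (ltnW (ltnW d3)); pose a1 : 'I_d := Ordinal (ltnW d3).
pose a2 : 'I_d := Ordinal d3.
have colE (a b : 'I_d) : a != b -> (if (a <= 1) && (b <= 1) then c0 else c1) = c.
  move=> ab; have [|_ <-] := fE (f1 a) (f1 b).
    by rewrite /adj /= /complete_rel (can_eq fK).
  rewrite !fK; congr (if _ then _ else _).
  apply/andP/forall_inP => [[a1' b1'] x|H]; last first.
    by split; apply: H; rewrite !inE eqxx ?orbT.
  by rewrite !inE => /orP[]/eqP->.
have := colE a0 a1 isT; have := colE a0 a2 isT => /= <-.
by move/(congr1 val).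
Qed.

(** * Blow-ups *)

Section BlowUp.
Variables (V : finType) (e : rel V) (m p : nat).
Hypotheses (esym : symmetric e) (eirr : irreflexive e).

Definition blowup_adj : rel (V * 'I_m + 'I_p) := fun x y =>
  match x, y with
  | inl a, inl b => e a.1 b.1
  | inr i, inr j => i != j
  | _, _ => false
  end.

Lemma blowup_sym : symmetric blowup_adj.
Proof. by move=> [a|i] [b|j] //=; rewrite 1?esym 1?eq_sym. Qed.

Lemma blowup_irr : irreflexive blowup_adj.
Proof. by move=> [a|i] /=; rewrite ?eirr ?eqxx. Qed.

Definition blowup := SGraph blowup_sym blowup_irr.

Lemma blowup_order : graph_order blowup = #|V| * m + p.
Proof. by rewrite /graph_order card_sum card_prod !card_ord. Qed.

(** A clique meeting the blow-up stays inside it and projects injectively to a clique of [e],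
    because the copies of one vertex are independent; any other clique lies in the added [K_p]. *)
Lemma blowup_clique_number k : k <= p -> cliques_le k e -> clique_number blowup = p.
Proof.
move=> kp cle; pose Kp : {set blowup} := [set inr i | i : 'I_p].
have cKp : #|Kp| = p by rewrite card_imset ?card_ord // => i j [].
apply/eqP; rewrite eqn_leq; apply/andP; split.
  apply/bigmax_leqP => A /forall_inP clA.
  have {}clA x y : x \in A -> y \in A -> x != y -> blowup_adj x y.
    by move=> /clA/forall_inP clx /clx/implyP.
  have [a aA|no] := pickP [pred a | inl a \in A].
    pose pr (x : blowup) := if x is inl b then b.1 else a.1.
    have prA x y : x \in A -> y \in A -> x != y -> e (pr x) (pr y).
      have inlA z : z \in A -> exists b, z = inl b.
        case: z => [b|i] zA; first by exists b.
        by have := clA _ _ aA zA isT.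
      move=> xA yA; have [b xE] := inlA x xA; have [c yE] := inlA y yA.
      by rewrite xE yE in xA yA *; apply: clA.
    have inj : {in A &, injective pr}.
      move=> x y xA yA xy; apply/eqP/negPn/negP => /(prA x y xA yA).
      by rewrite xy eirr.
    rewrite -(card_in_imset inj) (leq_trans _ kp) //; apply: cle.
    move=> _ _ /imsetP[x xA ->] /imsetP[y yA ->] xy; apply: prA => //.
    by apply: contraNneq xy => ->.
  rewrite -cKp; apply/subset_leq_card/subsetP => -[a aA|i _]; last exact: imset_f.
  by have := no a; rewrite /= aA.
rewrite -[leqLHS]cKp; apply: leq_bigmax_cond; apply/forall_inP => _ /imsetP[i _ ->].
by apply/forall_inP => _ /imsetP[j _ ->]; apply/implyP.
Qed.

End BlowUp.

Lemma blowup_arrows (V : finType) (e : rel V) (esym : symmetric e)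
    (eirr : irreflexive e) (D r : nat) : 0 < r ->
  (forall col : V -> V -> 'I_r, exists (h : 'I_D.+1 -> V) c,
      forall i j : 'I_D.+1, i < j -> e (h i) (h j) /\ col (h i) (h j) = c) ->
  exists B, forall (G : sgraph) p, 0 < #|G| -> max_degree G <= D ->
    arrows r (blowup (B * #|G|) p esym eirr) G.
Proof.
move=> r0 ram; set q := 2 * r; set K := 2 * D.+1 * q ^ D.
have qD0 : 0 < q ^ D by rewrite expn_gt0 muln_gt0 r0.
have K0 : 0 < K by rewrite muln_gt0.
pose L := [seq p <- enum {: V * V} | p.1 != p.2].
have [|M [M0 HM]] := @lower_dense_family V 'I_r L K K0 _ (filter_all _ _).
  by rewrite card_ord.
(* [M] compensates for the shrinking; [2 * q ^ D] is the class size per vertex of [G] that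
   [embed_dense] requires. *)
exists (M * (2 * q ^ D)) => G p G0 degG col.
set m := _ * #|G|; set F := blowup m p esym eirr.
have m0 : 0 < m by rewrite !muln_gt0 M0 qD0.
pose A (v : V) : {set F} := [set inl (v, i) | i : 'I_m].
have cA v : #|A v| = m by rewrite card_imset ?card_ord // => i j [].
have [|A' [sA' dA']] := HM F (fun x y => col [set x; y]) A.
  by move=> v; rewrite cA.
have /choice[colV colVP] : forall u : V * V, exists c, u.1 != u.2 ->
    lower_dense K q (fun x y => col [set x; y] == c) (A' u.1) (A' u.2).
  (* The color on the diagonal is arbitrary: adjacent [h i] and [h j] are distinct. *)
  move=> u; have [->|uu] := eqVneq u.1 u.2; first by exists (Ordinal r0).
  have [|c] := dA' u; first by rewrite mem_filter uu mem_enum.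
  by rewrite card_ord -/q; exists c.
have [h [c hP]] := ram (fun x y => colV (x, y)).
have degG' (x : G) : #|[set y | adj x y]| <= D.
  apply: leq_trans degG.
  exact: (leq_bigmax_cond (F := fun x : G => #|[set y | adj x y]|)).
have [kap kapP] := greedy_coloring (@adj_sym G) (@adj_irr G) degG'.
have [|||f [finj fU fe]] := @embed_dense F G (fun x y => col [set x; y] == c)
  (@adj G) D D.+1 q kap (A' \o h) _ (@adj_sym G) degG' kapP.
- by rewrite muln_gt0 r0.
- move=> i j ij; have [eij <-] := hP i j ij; apply: (colVP (h i, h j)).
  by apply: contraTneq eij => /= ->; rewrite eirr.
- move=> i; have [_] := sA' (h i); rewrite cA /m -mulnA leq_pmul2l //.
exists c, f; split=> // x y.
suff lt x' y' : adj x' y' -> kap x' < kap y' ->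
    adj (f x') (f y') /\ col [set f x'; f y'] = c.
  move=> axy; have := kapP x y axy; rewrite neq_ltn => /orP[|yx]; first exact: lt.
  have [a <-] := lt y x (etrans (adj_sym y x) axy) yx.
  by rewrite adj_sym a setUC.
move=> axy xy; split; last exact/eqP/fe.
have fA z : exists i, f z = inl (h (kap z), i).
  by have /imsetP[i _ ->] := subsetP (sA' (h (kap z))).1 _ (fU z); exists i.
have [i ->] := fA x'; have [j ->] := fA y'.
by have [] := hP _ _ xy.
Qed.

(** * The linear bound *)

Theorem theorem4 (R : realType) (Delta r p : nat)
    (hDelta : (3 <= Delta)%N) (hr : (2 <= r)%N)
    (hp : ramsey r (complete Delta) = Some p) :
  exists c : R, (0 < c)%R /\
    forall (n : nat) (G : sgraph),
      (0 < n)%N -> graph_order G = n -> (max_degree G <= Delta)%N ->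
      (ereal_of_onat R (folkman r G p) <= (c * n%:R)%:E)%E.
Proof.
have ltp := arrows_complete_gt hDelta hr (smallest_Some hp).
have [||V [e [esym eirr cle ram]]] := @folkman_clique Delta.+1 'I_r.
- by lia.
- by rewrite card_ord ltnW.
have [B arr] := blowup_arrows esym eirr (ltnW hr) ram.
(* The order is [#|V| * (B * n) + p]; since [n >= 1], the summand [p] is at most [p * n]. *)
exists (#|V| * B + p)%:R%R; split; first by rewrite Num.Theory.ltr0n; lia.
move=> n G n0 Gn degG; rewrite /folkman.
have [|N -> le] := @smallest_le (fun N => exists F : sgraph,
    [/\ graph_order F = N, clique_number F = p & arrows r F G])
    (#|V| * (B * n) + p).
  exists (blowup (B * n) p esym eirr); split.
  - exact: blowup_order.
  - exact: blowup_clique_number cle.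
  - by rewrite -Gn; apply: arr => //; rewrite -[#|_|]/(graph_order G) Gn.
rewrite lee_fin -GRing.natrM Num.Theory.ler_nat; apply: leq_trans le _.
by rewrite mulnDl mulnA leq_add2l leq_pmulr.
Qed.
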